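(* Let $1\le M\le N$ be integers, $s,t\ge0$, and $$x_n=n^{-3/2}\bigl(s\mathbf 1_{\{1\le n\le M\}}+t\mathbf 1_{\{1\le n\le N\}}\bigr)\qquad(n\ge1).$$ Then $\mathcal C(x)<2AE_3$ unless $s=t=0$. The result holds for all cutoffs $M\le N$ and remains true after a common frequency dilation, i.e. for the sequence $x'$ with $x'_{qn}=x_n$ ($n\ge1$) and $x'_k=0$ for $q\nmid k$, for any integer $q\ge1$.
   Context: For a nonnegative sequence $x=(x_n)_{n\ge1}$, $$A=\sum_{n\ge1}x_n,\qquad E_3=\sum_{n\ge1}n^3x_n^2,\qquad \mathcal C(x)=\sum_{a,b\ge1}(a+b)(a^2+ab+b^2)x_ax_bx_{a+b}.$$ *)

(* Defs.v *)
From HB Require Import structures.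
From mathcomp Require Import all_boot all_order all_algebra.
From mathcomp Require Import all_classical all_reals all_analysis.
Set Implicit Arguments.
Unset Strict Implicit.
Unset Printing Implicit Defensive.
Import Order.TTheory GRing.Theory Num.Theory.
Import numFieldNormedType.Exports.
Local Open Scope classical_set_scope.
Local Open Scope ring_scope.

(* A nonnegative sequence (x_n)_{n >= 1} is a function nat -> R whose value at
   0 is never used.  The sums are taken in \bar R, so that they make sense for
   every nonnegative sequence, summable or not. *)

Definition seqA (R : realType) (x : nat -> R) : \bar R :=
  (\sum_(1 <= n <oo) (x n)%:E)%E.

Definition seqE3 (R : realType) (x : nat -> R) : \bar R :=
  (\sum_(1 <= n <oo) (n%:R ^+ 3 * x n ^+ 2)%:E)%E.

Definition seqC (R : realType) (x : nat -> R) : \bar R :=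
  (\esum_(p in [set p : nat * nat | (1 <= p.1)%N /\ (1 <= p.2)%N])
    let a := p.1 in let b := p.2 in
    ((a + b)%:R * (a ^ 2 + a * b + b ^ 2)%:R * x a * x b * x (a + b)%N)%:E)%E.

Definition two_step (R : realType) (M N : nat) (s t : R) (n : nat) : R :=
  n%:R `^ (- (3 / 2)) *
  (s * (1 <= n <= M)%N%:R + t * (1 <= n <= N)%N%:R).

Definition dilate (R : realType) (q : nat) (x : nat -> R) (k : nat) : R :=
  if (q %| k)%N then x (k %/ q)%N else 0.

(* Main.v *)
Require Import Defs.
From mathcomp Require Import all_boot all_order all_algebra.
From mathcomp Require Import all_classical all_reals all_analysis.
From mathcomp Require Import ring lra zify.
Import Order.TTheory GRing.Theory Num.Theory.
Local Open Scope ring_scope.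

(** Write x_n = n^(-3/2) w_n, so that w is s + t up to M, then t up to N, then 0.
Then E_3 is the sum of the w_n^2, A is the sum of the n^(-3/2) w_n, and C is the
sum over a, b of w_a w_b w_(a+b) K(a, b) with
  K(a, b) = (a^2 + a b + b^2) / ((a b)^(3/2) (a + b)^(1/2)).

For a much smaller than b the kernel is close to a^(-3/2), and for a <= b it is
at most a^(-3/2) + b^(-3/2) + g(a, b) with an explicit g ([kernel_le]).  If the
term g were absent and w_(a+b) were replaced by w_b, then C would become at most
twice the sum of a^(-3/2) w_a w_b^2, which is exactly 2 A E_3: the two sides
agree to leading order, and the comparison is won at the next order, where the
natural unit is H_n = sum_(k <= n) k^(-1/2), of size 2 sqrt n.

Gain: shifting the index in sum_b w_b w_(a+b) loses about a terms of E_3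
([weight_correlation_le]); summed against a^(-3/2) w_a this subtracts from
2 A E_3 the quantity 2 (s^3 + 2 s^2 t + 2 s t^2) H_M + 2 t^3 H_N
([sum_leading_le]).

Loss: since w is nonincreasing, the terms g(a, b) with a <= b are weighted by at
most w_a w_b^2.  The sum of g(a, b) over a <= b is at most (5/9) b^(-1/2)
([sum_excess_le]), and the only other contribution comes from a <= M < b, where
g(a, b) <= 1 / (2 sqrt a b) produces a harmonic sum ([sum_excess_total_le]).

With L half the harmonic sum over M < k <= N, gain minus loss is
  H_M (8/9 s^3 + 2/3 s^2 t + (2/3 - 2 L) s t^2) + 8/9 t^3 H_N.
The coefficient of s t^2 tends to minus infinity as N / M grows, so positivity
cannot be read off coefficient by coefficient.  But H_N / H_M grows like
sqrt (N / M), that is like exp L; in fact it is at least the cubic Taylor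
polynomial of exp L ([invsqrt_sum_growth]), and then s^2 t and t^3 together dominate s t^2
([cutoff_margin_gt0]).

Dilation by q multiplies both C and E_3 by q^3 and leaves A unchanged, so the
second half of the theorem follows from the first. *)

Set Implicit Arguments.
Unset Strict Implicit.
Unset Printing Implicit Defensive.

(** * Two polynomial inequalities *)

(** The kernel bound after squaring, in terms of x = sqrt (a / b).  The quartic on
the right agrees with the expansion of (1 + x^2 + x^4) / sqrt (1 + x^2) at 0 up to
x^2; its x^3 and x^4 coefficients were taken so that it stays above on [0, 1]
while keeping the integral that governs [sum_excess_le] small. *)
Lemma kernel_poly (R : realType) (x : R) : 0 <= x -> x <= 1 ->
  (1 + x ^+ 2 + x ^+ 4) ^+ 2 <=
  (1 + x ^+ 2) * (1 + x ^+ 2 / 2 + x ^+ 3 / 3 + x ^+ 4 / 3) ^+ 2.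
Proof.
move=> x0 x1.
(* The difference of the two sides is x ^ 3 times this polynomial. *)
have h : 0 <= 2 / 3 - 13 / 12 * x + x ^+ 2 - 23 / 36 * x ^+ 3 + 5 / 9 * x ^+ 4
     - 4 / 9 * x ^+ 5 + 2 / 9 * x ^+ 6 + 1 / 9 * x ^+ 7.
  (* 23 / 40 minimizes 5/9 x^2 - 23/36 x; 13 / 20 nearly minimizes what is left
  of the lowest-order terms. *)
  have e1 : 0 <= x ^+ 2 * (x - 23 / 40) ^+ 2.
    by rewrite mulr_ge0 ?sqr_ge0.
  have e2 : 0 <= 1 - x ^+ 5 by rewrite subr_ge0 exprn_ile1.
  have e3 : 0 <= x ^+ 5 * (1 - x) ^+ 2 by rewrite mulr_ge0 ?sqr_ge0 ?exprn_ge0.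
  have e4 : 0 <= (x - 13 / 20) ^+ 2 by rewrite sqr_ge0.
  have e5 : 0 <= x ^+ 6 by rewrite exprn_ge0.
  have e6 : 0 <= x ^+ 7 by rewrite exprn_ge0.
  have e7 : 0 <= x ^+ 2 by rewrite exprn_ge0.
  nra.
have h3 : 0 <= x ^+ 3 by rewrite exprn_ge0.
have := mulr_ge0 h3 h; lra.
Qed.

(** For t > 0 the terms other than s^3 are t times a quadratic form in s and t,
which is positive because its discriminant is negative: 3/2 (L - 1/3)^2 is below
8/9 times the cubic Taylor polynomial of exp L. *)
Lemma cutoff_margin_gt0 (R : realType) (s t L : R) :
  0 <= s -> 0 <= t -> ~ (s = 0 /\ t = 0) -> 0 <= L ->
  0 < 8 / 9 * s ^+ 3 + 2 / 3 * s ^+ 2 * t + (2 / 3 - 2 * L) * s * t ^+ 2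
      + 8 / 9 * t ^+ 3 * (1 + L + L ^+ 2 / 2 + L ^+ 3 / 6).
Proof.
move=> s0 t0 st L0.
have s3 : 0 <= s ^+ 3 by rewrite exprn_ge0.
have := t0; rewrite le_eqVlt => /predU1P[te|tp].
  rewrite -te in st *.
  have : 0 < s by rewrite lt_def s0 andbT; apply/eqP => se; apply: st.
  by move=> /(exprn_gt0 3); nra.
suff : 0 < 2 / 3 * s ^+ 2 + (2 / 3 - 2 * L) * s * t
      + 8 / 9 * t ^+ 2 * (1 + L + L ^+ 2 / 2 + L ^+ 3 / 6).
  by move=> /(mulr_gt0 tp); nra.
have t2 : 0 < t ^+ 2 by rewrite exprn_gt0.
have key : 0 < 8 / 9 * (1 + L + L ^+ 2 / 2 + L ^+ 3 / 6) - 3 / 2 * (L - 1 / 3) ^+ 2.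
  (* As a cubic in L, the goal is tightest near L = 7 / 2. *)
  have : 0 <= L * (L - 7 / 2) ^+ 2 by rewrite mulr_ge0 ?sqr_ge0.
  nra.
have := sqr_ge0 (s - 3 / 2 * (L - 1 / 3) * t).
have := mulr_gt0 t2 key.
nra.
Qed.

(** * The kernel and its excess over the leading terms *)

Section Kernel.
Variable R : realType.
Implicit Types a b k n m : nat.

Local Notation "\rt n" := (Num.sqrt (n%:R : R)) (at level 9, n at level 8).

Definition kernel a b : R :=
  (a ^ 2 + a * b + b ^ 2)%:R / (a%:R * \rt a * (b%:R * \rt b) * \rt (a + b)).

Definition pow32 n : R := (n%:R * \rt n)^-1.

(** The upper bound for K(a, b) - a^(-3/2) - b^(-3/2) when a <= b; in terms of
x = sqrt (a / b) it is b^(-3/2) (1 / (2 x) - 2/3 + x / 3). *)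
Definition excess a b : R :=
  (2 * \rt a * b%:R)^-1 - 2 / 3 * pow32 b + \rt a / (3 * b%:R ^+ 2).

Definition invsqrt_sum n : R := \sum_(1 <= k < n.+1) (\rt k)^-1.

Definition harmonic_sum n : R := \sum_(1 <= k < n.+1) k%:R^-1.

Lemma sqrt_nat_gt0 n : (0 < n)%N -> 0 < \rt n.
Proof. by move=> n0; rewrite sqrtr_gt0 ltr0n. Qed.

Lemma sqr_sqrt_nat n : \rt n ^+ 2 = n%:R.
Proof. by rewrite sqr_sqrtr ?ler0n. Qed.

Lemma kernelC a b : kernel a b = kernel b a.
Proof.
rewrite /kernel (addnC b a) (mulrC (b%:R * _)).
by congr (_%:R / _); lia.
Qed.

(** With x = sqrt (a / b), multiplying through by a^(3/2) sqrt (1 + x^2) turns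
this into the square root of [kernel_poly]. *)
Lemma kernel_le a b : (0 < a <= b)%N ->
  kernel a b <= pow32 a + pow32 b + excess a b.
Proof.
move=> /andP[a0 ab]; have b0 : (0 < b)%N by exact: leq_trans ab.
rewrite /excess /pow32 /kernel.
have u0 := sqrt_nat_gt0 a0; have v0 := sqrt_nat_gt0 b0.
have z0 : 0 < \rt (a + b) by rewrite sqrt_nat_gt0 ?addn_gt0 ?a0.
have uv : \rt a <= \rt b by rewrite ler_sqrt ?ler_nat.
have zE : \rt (a + b) ^+ 2 = \rt a ^+ 2 + \rt b ^+ 2.
  by rewrite !sqr_sqrt_nat natrD.
have -> : (a ^ 2 + a * b + b ^ 2)%:R =
    (\rt a ^+ 2) ^+ 2 + \rt a ^+ 2 * \rt b ^+ 2 + (\rt b ^+ 2) ^+ 2.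
  by rewrite !sqr_sqrt_nat -!natrX -natrM -!natrD.
have uE := sqr_sqrt_nat a; have vE := sqr_sqrt_nat b.
move: (\rt a) (\rt b) (\rt (a + b)) u0 v0 z0 uv zE uE vE
  => u v z u0 v0 z0 uv zE uE vE.
rewrite -{}uE -{}vE.
have uE : u = u / v * v by rewrite divfK // gt_eqF.
have x0 : 0 < u / v by rewrite divr_gt0.
have x1 : u / v <= 1 by rewrite ler_pdivrMr // mul1r.
move: (u / v) uE x0 x1 => x uE x0 x1.
have := kernel_poly (ltW x0) x1.
set P := 1 + x ^+ 2 + x ^+ 4; set Q := 1 + x ^+ 2 / 2 + x ^+ 3 / 3 + x ^+ 4 / 3.
move=> PQ.
have P0 : 0 <= P by rewrite !addr_ge0 ?exprn_ge0 // ltW.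
have Q0 : 0 <= Q.
  by rewrite /Q !addr_ge0 ?divr_ge0 ?exprn_ge0 // ltW.
have PQz : P * v <= z * Q.
  rewrite -(@ler_pXn2r _ 2) ?nnegrE ?mulr_ge0 ?(ltW z0) ?(ltW v0) //.
  rewrite 2!exprMn zE uE.
  have -> : (x * v) ^+ 2 + v ^+ 2 = (1 + x ^+ 2) * v ^+ 2 by ring.
  by rewrite [leRHS]mulrAC ler_wpM2r ?sqr_ge0.
rewrite uE.
have -> : ((x * v) ^+ 2) ^+ 2 + (x * v) ^+ 2 * v ^+ 2 + (v ^+ 2) ^+ 2 = P * v ^+ 4.
  by rewrite /P; ring.
rewrite -subr_ge0.
have -> : ((x * v) ^+ 2 * (x * v))^-1 + (v ^+ 2 * v)^-1 +
   ((2 * (x * v) * v ^+ 2)^-1 - 2 / 3 * (v ^+ 2 * v)^-1 +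
    x * v / (3 * (v ^+ 2) ^+ 2)) -
   P * v ^+ 4 / ((x * v) ^+ 2 * (x * v) * (v ^+ 2 * v) * z) =
   (z * Q - P * v) / (z * x ^+ 3 * v ^+ 3).
  rewrite /Q; field; by rewrite !gt_eqF.
by rewrite divr_ge0 ?subr_ge0 // ltW // !mulr_gt0 ?exprn_gt0.
Qed.

Lemma pow32_gt0 n : (0 < n)%N -> 0 < pow32 n.
Proof. by move=> n0; rewrite invr_gt0 mulr_gt0 ?ltr0n ?sqrt_nat_gt0. Qed.

Lemma excess_ge0 a b : (0 < a <= b)%N -> 0 <= excess a b.
Proof.
move=> /andP[a0 ab]; have b0 : (0 < b)%N by exact: leq_trans ab.
rewrite /excess /pow32.
have u0 := sqrt_nat_gt0 a0; have v0 := sqrt_nat_gt0 b0.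
have uE := sqr_sqrt_nat a; have vE := sqr_sqrt_nat b.
move: (\rt a) (\rt b) u0 v0 uE vE => u v u0 v0 _ <-.
have -> : (2 * u * v ^+ 2)^-1 - 2 / 3 * (v ^+ 2 * v)^-1 + u / (3 * (v ^+ 2) ^+ 2)
  = ((u - v) ^+ 2 * 2 + v ^+ 2) / (6 * u * v ^+ 4).
  by field; rewrite !gt_eqF.
apply: divr_ge0; last by rewrite ltW // !mulr_gt0 ?exprn_gt0.
by rewrite addr_ge0 ?sqr_ge0 // mulr_ge0 ?sqr_ge0.
Qed.

Lemma excess_le a b : (0 < a <= b)%N -> excess a b <= (2 * \rt a * b%:R)^-1.
Proof.
move=> /andP[a0 ab]; have b0 : (0 < b)%N by exact: leq_trans ab.
rewrite /excess /pow32.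
have u0 := sqrt_nat_gt0 a0; have v0 := sqrt_nat_gt0 b0.
have uv : \rt a <= \rt b by rewrite ler_sqrt ?ler_nat.
have vE := sqr_sqrt_nat b; rewrite -subr_ge0.
move: (\rt a) (\rt b) u0 v0 uv vE => u v u0 v0 uv <-.
have -> : (2 * u * v ^+ 2)^-1 - ((2 * u * v ^+ 2)^-1 - 2 / 3 * (v ^+ 2 * v)^-1
   + u / (3 * (v ^+ 2) ^+ 2)) = (2 * v - u) / (3 * v ^+ 4).
  by field; rewrite !gt_eqF.
apply: divr_ge0; first lra.
by rewrite ltW // !mulr_gt0 ?exprn_gt0.
Qed.

Lemma invsqrt_sumS n : invsqrt_sum n.+1 = invsqrt_sum n + (\rt n.+1)^-1.
Proof. by rewrite /invsqrt_sum big_nat_recr. Qed.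

Lemma harmonic_sumS n : harmonic_sum n.+1 = harmonic_sum n + n.+1%:R^-1.
Proof. by rewrite /harmonic_sum big_nat_recr. Qed.

(** The sum is compared with the integral of 1 / sqrt.  The additive gain of 1 is
kept because it pays for the lower-order terms in [sum_excess_le]. *)
Lemma invsqrt_sum_le n : (0 < n)%N -> invsqrt_sum n <= 2 * \rt n - 1.
Proof.
elim: n => // -[_ _|n /(_ isT) IH _].
  by rewrite invsqrt_sumS /invsqrt_sum big_geq // sqrtr1; lra.
rewrite invsqrt_sumS; move: IH.
have u0 : 0 < \rt n.+1 by rewrite sqrt_nat_gt0.
have v0 : 0 < \rt n.+2 by rewrite sqrt_nat_gt0.
have : \rt n.+2 ^+ 2 = \rt n.+1 ^+ 2 + 1 by rewrite !sqr_sqrt_nat -natr1.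
move: (\rt n.+1) (\rt n.+2) u0 v0 (invsqrt_sum _) => u v u0 v0 S uv IH.
suff : v^-1 <= 2 * (v - u) by lra.
rewrite -[v^-1]mul1r ler_pdivrMr //.
have := sqr_ge0 (v - u); nra.
Qed.

Lemma sqrt_sum_le n : \sum_(1 <= k < n.+1) \rt k <= 2 / 3 * n%:R * \rt n + \rt n.
Proof.
elim: n => [|n IH]; first by rewrite big_geq // sqrtr0 !mulr0 addr0.
rewrite big_nat_recr //=.
have u0 : 0 <= \rt n by rewrite sqrtr_ge0.
have v0 : 0 < \rt n.+1 by rewrite sqrt_nat_gt0.
have uv1 : \rt n.+1 ^+ 2 = \rt n ^+ 2 + 1 by rewrite !sqr_sqrt_nat -natr1.
have uv : \rt n <= \rt n.+1 by rewrite ler_sqrt ?ler_nat.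
have uE := sqr_sqrt_nat n; have vE := sqr_sqrt_nat n.+1; move: IH.
move: (\sum_(1 <= k < _) _) (\rt n) (\rt n.+1) u0 v0 uv uv1 uE vE
  => S u v u0 v0 uv uv1 <- <- IH.
(* Induction reduces to comparing sqrt n with the integral of sqrt over
[n, n + 1]; with u, v the roots of n, n + 1 the gap is (v - u)^2 (2 v + u) / 3. *)
suff : 0 <= 2 / 3 * v ^+ 3 - 2 / 3 * u ^+ 3 - u by lra.
have d : (v - u) * (v + u) = 1 by rewrite -subr_sqr uv1 addrAC subrr add0r.
have -> : 2 / 3 * v ^+ 3 - 2 / 3 * u ^+ 3 - u =
    (v - u) ^+ 2 * (2 * v + u) / 3 + u * ((v - u) * (v + u) - 1) by field.
rewrite d subrr mulr0 addr0 divr_ge0 ?ler0n // mulr_ge0 ?sqr_ge0 //; lra.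
Qed.

(** For large b the sum is close to b^(-1/2) times the integral over x in [0, 1] of
2 x (1 / (2 x) - 2/3 + x / 3), which is 1 - 2/3 + 2/9 = 5/9; the error terms have
a favourable total sign. *)
Lemma sum_excess_le b : (0 < b)%N ->
  \sum_(1 <= a < b.+1) excess a b <= 5 / 9 * (\rt b)^-1.
Proof.
move=> b0; rewrite /excess big_split /= sumrB.
have -> : \sum_(1 <= a < b.+1) (2 * \rt a * b%:R)^-1 =
    2^-1 * invsqrt_sum b / b%:R.
  rewrite /invsqrt_sum mulr_sumr mulr_suml.
  by apply: eq_bigr => a _; rewrite !invfM.
rewrite [X in _ - X + _]big_const_nat subn1 /= iter_addr_0.
rewrite -[_ * pow32 b *+ b]mulr_natl -mulr_suml.
have := invsqrt_sum_le b0; have := sqrt_sum_le b.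
have v0 := sqrt_nat_gt0 b0.
have v1 : 1 <= \rt b by rewrite -[leLHS]sqrtr1 ler_sqrt ?ler1n // ler0n.
have vE := sqr_sqrt_nat b; rewrite /pow32.
move: (\rt b) (invsqrt_sum b) (\sum_(_ <= _ < _) _) v0 v1 vE
  => v S T v0 v1 <- hT hS.
apply: (@le_trans _ _ (2^-1 * (2 * v - 1) / v ^+ 2 - v ^+ 2 * (2 / 3 * (v ^+ 2 * v)^-1)
   + (2 / 3 * v ^+ 2 * v + v) / (3 * (v ^+ 2) ^+ 2))).
  rewrite lerD ?lerB //.
    by rewrite ler_wpM2r ?invr_ge0 ?exprn_ge0 ?(ltW v0) //; lra.
  by rewrite ler_wpM2r // invr_ge0 ltW // mulr_gt0 ?exprn_gt0.
rewrite -subr_ge0.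
have -> : 5 / 9 * v^-1 -
   (2^-1 * (2 * v - 1) / v ^+ 2 - v ^+ 2 * (2 / 3 * (v ^+ 2 * v)^-1) +
    (2 / 3 * v ^+ 2 * v + v) / (3 * (v ^+ 2) ^+ 2)) =
  (v / 2 - 1 / 3) / v ^+ 3.
  by field; rewrite gt_eqF.
by rewrite divr_ge0 ?exprn_ge0 // ?(ltW v0) //; lra.
Qed.

(** From H_(k+1) <= 2 sqrt (k+1) one gets H_k <= (1 - y) H_(k+1) with
y = 1 / (2 (k+1)), which is also the increment of L.  So H grows at least like
exp L.  The Taylor polynomial P of exp of degree 3 is enough, and satisfies
(1 - y) P(L + y) <= P(L) because P' <= P on the nonnegative reals. *)
Lemma invsqrt_sum_growth m n : (m <= n)%N ->
  let L := (harmonic_sum n - harmonic_sum m) / 2 in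
  0 <= L /\ invsqrt_sum m * (1 + L + L ^+ 2 / 2 + L ^+ 3 / 6) <= invsqrt_sum n.
Proof.
have S0 k : 0 <= invsqrt_sum k.
  by rewrite sumr_ge0 // => i _; rewrite invr_ge0 sqrtr_ge0.
move=> /= /subnK <-; elim: (n - m)%N => [|d [L0 IH]].
  by rewrite add0n subrr mul0r lexx; split => //; lra.
rewrite addSn harmonic_sumS; set k := (d + m)%N in L0 IH *.
move: L0 IH; set L := (_ - _) / 2 => L0 IH.
set y : R := (2 * k.+1%:R)^-1.
have -> : (harmonic_sum k + k.+1%:R^-1 - harmonic_sum m) / 2 = L + y.
  by rewrite /y invfM [2^-1 * _]mulrC -mulrDl addrAC.
have y0 : 0 < y by rewrite invr_gt0 mulr_gt0 ?ltr0n.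
have y1 : y <= 1 / 2.
  rewrite div1r lef_pV2 ?posrE ?mulr_gt0 ?ltr0n //.
  by rewrite -[leLHS]mulr1 ler_wpM2l // ler1n.
have step : invsqrt_sum k <= (1 - y) * invsqrt_sum k.+1.
  suff : y * invsqrt_sum k.+1 <= (\rt k.+1)^-1.
    by move: (invsqrt_sumS k) => ->; lra.
  have r0 : 0 < \rt k.+1 by rewrite sqrt_nat_gt0.
  apply: (@le_trans _ _ (y * (2 * \rt k.+1))).
    rewrite ler_wpM2l ?(ltW y0) //.
    by apply: le_trans (invsqrt_sum_le (ltn0Sn k)) _; lra.
  have rE := sqr_sqrt_nat k.+1; rewrite /y.
  by move: (\rt k.+1) r0 rE => r r0 <-;
    rewrite (_ : _ * _ = r^-1) //; field; rewrite gt_eqF.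
split; first lra.
have y1' : 0 < 1 - y by lra.
rewrite -(ler_pM2l y1'); apply: le_trans step; apply: le_trans IH.
rewrite mulrCA ler_wpM2l //.
have : 0 <= L ^+ 3 * y by rewrite mulr_ge0 ?exprn_ge0 // ltW.
have : 0 <= L ^+ 2 * y ^+ 2 by rewrite mulr_ge0 ?exprn_ge0 // ltW.
have : 0 <= L * y ^+ 2 by rewrite mulr_ge0 ?exprn_ge0 // ltW.
have : 0 <= L * y ^+ 3 by rewrite mulr_ge0 ?exprn_ge0 // ltW.
have : 0 <= y ^+ 2 by rewrite exprn_ge0 // ltW.
have : 0 <= y ^+ 3 by rewrite exprn_ge0 // ltW.
have : 0 <= y ^+ 4 by rewrite exprn_ge0 // ltW.
lra.
Qed.

End Kernel.

(** * The cubic inequality for two cutoffs *)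

Lemma big_nat_if (R : nmodType) (F G : nat -> R) (m n : nat) : (m <= n)%N ->
  \sum_(1 <= k < n.+1) (if (k <= m)%N then F k else G k) =
  \sum_(1 <= k < m.+1) F k + \sum_(m.+1 <= k < n.+1) G k.
Proof.
move=> mn; rewrite (@big_cat_nat _ _ _ m.+1) //=; congr (_ + _).
  by apply: eq_big_nat => k /andP[_]; rewrite ltnS => ->.
by apply: eq_big_nat => k /andP[mk _]; rewrite leqNgt mk.
Qed.

Lemma sum_shifted_cutoff (R : realType) (a n m : nat) : (m <= n)%N ->
  \sum_(1 <= b < n.+1) (a + b <= m)%N%:R = (m - a)%N%:R :> R.
Proof.
move=> mn; rewrite -natr_sum; congr _%:R.
suff -> : (\sum_(1 <= b < n.+1) (a + b <= m) = minn n (m - a))%N by lia.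
elim: n {mn} => [|n IH]; first by rewrite big_geq // min0n.
by rewrite big_nat_recr //= IH; case: leqP; lia.
Qed.

Section TwoCutoffs.
Variables (R : realType) (M N : nat) (s t : R).
Hypotheses (M_gt0 : (0 < M)%N) (leMN : (M <= N)%N) (s_ge0 : 0 <= s) (t_ge0 : 0 <= t).
Implicit Types a b n : nat.

Definition weight n : R := s * (n <= M)%N%:R + t * (n <= N)%N%:R.

Lemma weight_le n : (n <= M)%N -> weight n = s + t.
Proof. by move=> nM; rewrite /weight nM (leq_trans nM leMN) !mulr1. Qed.

Lemma weight_gt n : (M < n <= N)%N -> weight n = t.
Proof.
by move=> /andP[Mn nN]; rewrite /weight nN leqNgt Mn mulr0 add0r mulr1.
Qed.

Lemma weight_ge0 n : 0 <= weight n.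
Proof. by rewrite addr_ge0 ?mulr_ge0. Qed.

Lemma weight_nincr m n : (m <= n)%N -> weight n <= weight m.
Proof.
by move=> mn; rewrite lerD // ler_wpM2l // ler_nat; case: leqP; case: leqP; lia.
Qed.

Definition energy : R := (s ^+ 2 + 2 * s * t) * M%:R + t ^+ 2 * N%:R.

Lemma sum_weight_sqr : \sum_(1 <= n < N.+1) weight n ^+ 2 = energy.
Proof.
transitivity (\sum_(1 <= n < N.+1)
    ((s ^+ 2 + 2 * s * t) * (0 + n <= M)%N%:R + t ^+ 2 * (0 + n <= N)%N%:R)).
  apply: eq_big_nat => n /andP[_]; rewrite ltnS !add0n /weight => ->.
  by case: leqP => _; rewrite ?mulr1 ?mulr0; ring.
by rewrite big_split /= -!mulr_sumr !sum_shifted_cutoff // !subn0.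
Qed.

(** In the expanded product every pair of cutoffs is dominated by one of the two,
which leaves counting functions.  A cutoff of a + b at m keeps only m - a values
of b, which costs a of them when a <= m.  For the term s t with cutoffs at M on b
and at N on a + b the second one is dropped, and nothing is gained. *)
Lemma weight_correlation_le a : (0 < a <= N)%N ->
  \sum_(1 <= b < N.+1) weight b * weight (a + b)%N <=
  energy - (if (a <= M)%N then s ^+ 2 + s * t + t ^+ 2 else t ^+ 2) * a%:R.
Proof.
move=> /andP[a0 aN].
apply: (@le_trans _ _ (\sum_(1 <= b < N.+1)
  ((s ^+ 2 + s * t) * (a + b <= M)%N%:R + s * t * (0 + b <= M)%N%:R
   + t ^+ 2 * (a + b <= N)%N%:R))).
  apply: ler_sum_nat => b /andP[_]; rewrite ltnS add0n /weight => ->.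
  have h : ((a + b <= M) ==> (b <= M))%N by apply/implyP; lia.
  have st0 := mulr_ge0 s_ge0 t_ge0.
  move: h; case: (a + b <= M)%N; case: (b <= M)%N;
    case: (a + b <= N)%N => //= _; rewrite ?mulr1 ?mulr0; nra.
rewrite !big_split /= -!mulr_sumr !sum_shifted_cutoff // subn0 /energy.
rewrite (natrB _ aN).
have st0 := mulr_ge0 s_ge0 t_ge0; have s2 := sqr_ge0 s.
have M0 : 0 <= M%:R :> R by [].
case: leqP => [aM|Ma]; first by rewrite (natrB _ aM); nra.
have -> : (M - a = 0)%N by lia.
have := mulr_ge0 st0 M0; have := mulr_ge0 s2 M0; nra.
Qed.

Lemma sum_tail_le (f : nat -> R) :
  \sum_(M.+1 <= n < N.+1) f n =
  \sum_(1 <= n < N.+1) f n - \sum_(1 <= n < M.+1) f n.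
Proof. by rewrite (@big_cat_nat _ _ _ M.+1 1 N.+1) //= [X in X - _]addrC addrK. Qed.

Local Notation H := (@invsqrt_sum R).
Local Notation h := (@harmonic_sum R).

(** The defect in [weight_correlation_le] is proportional to a, so against
a^(-3/2) w_a it sums to multiples of a^(-1/2), hence to H_M and H_N. *)
Lemma sum_leading_le :
  \sum_(1 <= a < N.+1) \sum_(1 <= b < N.+1)
    weight a * weight b * weight (a + b)%N * pow32 R a <=
  (\sum_(1 <= a < N.+1) weight a * pow32 R a) * energy
  - ((s ^+ 3 + 2 * s ^+ 2 * t + 2 * s * t ^+ 2) * H M + t ^+ 3 * H N).
Proof.
apply: (@le_trans _ _ (\sum_(1 <= a < N.+1) (weight a * pow32 R a * energy
   - (if (a <= M)%N then (s + t) * (s ^+ 2 + s * t + t ^+ 2) / Num.sqrt a%:R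
      else t ^+ 3 / Num.sqrt a%:R)))).
  apply: ler_sum_nat => a /andP[a0]; rewrite ltnS => aN.
  have -> : \sum_(1 <= b < N.+1) weight a * weight b * weight (a + b)%N * pow32 R a
     = weight a * pow32 R a * \sum_(1 <= b < N.+1) weight b * weight (a + b)%N.
    by rewrite mulr_sumr; apply: eq_bigr => b _; ring.
  have w0 : 0 <= weight a * pow32 R a by rewrite mulr_ge0 ?weight_ge0 // ltW ?pow32_gt0.
  have a0N : (0 < a <= N)%N by rewrite a0.
  apply: le_trans (ler_wpM2l w0 (weight_correlation_le a0N)) _.
  rewrite mulrBr lerD2l lerN2.
  have pa : pow32 R a * a%:R = (Num.sqrt a%:R)^-1.
    by rewrite /pow32 invfM mulrC mulrA divff ?mul1r // pnatr_eq0 -lt0n.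
  case: (leqP a M) => [aM|Ma]; rewrite -pa.
    by rewrite weight_le //; lra.
  by rewrite weight_gt ?Ma //; lra.
rewrite sumrB -mulr_suml big_nat_if // sum_tail_le -!mulr_sumr.
rewrite -/(H M) -/(H N).
apply: lerD => //; lra.
Qed.

(** When b > M the terms with a <= M carry the extra weight s.  There the excess is
bounded by its first term alone, which separates the variables. *)
Lemma sum_weight_excess_le b : (0 < b <= N)%N ->
  \sum_(1 <= a < b.+1) weight a * excess R a b <=
  if (b <= M)%N then (s + t) * (5 / 9 / Num.sqrt b%:R)
  else t * (5 / 9 / Num.sqrt b%:R) + s * (H M / (2 * b%:R)).
Proof.
move=> /andP[b0 bN]; have [bM|Mb] := leqP b M.
  under eq_big_nat => a /andP[_ ab] do rewrite weight_le ?(leq_trans _ bM) //.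
  by rewrite -mulr_sumr ler_wpM2l ?addr_ge0 // sum_excess_le.
have -> : \sum_(1 <= a < b.+1) weight a * excess R a b =
    t * \sum_(1 <= a < b.+1) excess R a b
    + s * \sum_(1 <= a < b.+1) (if (a <= M)%N then excess R a b else 0).
  rewrite !mulr_sumr -big_split /=; apply: eq_big_nat => a /andP[_ ab].
  rewrite /weight (leq_trans _ bN) //.
  by case: leqP => _; rewrite ?mulr1 ?mulr0; ring.
rewrite lerD ?ler_wpM2l ?sum_excess_le //.
rewrite big_nat_if ?(ltnW Mb) // [X in _ + X <= _]big1_eq addr0 /invsqrt_sum mulr_suml.
apply: ler_sum_nat => a /andP[a0 aM].
apply: le_trans (excess_le _ _) _; first by lia.
by rewrite !invfM mulrCA mulrA.
Qed.

(** As w is nonincreasing, w_(a+b) <= w_b, which leaves w_b^2 times the sum of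
[sum_weight_excess_le].  The harmonic sum over M < b <= N is the source of the
logarithmic loss. *)
Lemma sum_excess_total_le :
  \sum_(1 <= a < N.+1) \sum_(1 <= b < N.+1)
    weight a * weight b * weight (a + b)%N
      * (if (a <= b)%N then excess R a b else 0) <=
  5 / 9 * ((s + t) ^+ 3 * H M + t ^+ 3 * (H N - H M))
  + s * t ^+ 2 * H M * ((h N - h M) / 2).
Proof.
rewrite exchange_big_nat /=.
apply: (@le_trans _ _ (\sum_(1 <= b < N.+1)
   (if (b <= M)%N then 5 / 9 * (s + t) ^+ 3 / Num.sqrt b%:R else
    5 / 9 * t ^+ 3 / Num.sqrt b%:R + s * t ^+ 2 * H M / 2 / b%:R))).
  apply: ler_sum_nat => b /andP[b0]; rewrite ltnS => bN.
  have b0N : (0 < b <= N)%N by rewrite b0.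
  have w2 : 0 <= weight b ^+ 2 by rewrite sqr_ge0.
  apply: (@le_trans _ _ (weight b ^+ 2 *
      \sum_(1 <= a < b.+1) weight a * excess R a b)).
    have z : \sum_(b.+1 <= a < N.+1) 0 = 0 :> R by rewrite big1_eq.
    rewrite -[leRHS]addr0 -[X in _ <= _ + X]z.
    rewrite mulr_sumr -big_nat_if //; apply: ler_sum_nat => a /andP[a0 _].
    case: leqP => [ab|_]; last by rewrite mulr0.
    rewrite mulrA ler_wpM2r ?excess_ge0 ?a0 //.
    rewrite [leRHS]mulrC expr2 mulrA ler_wpM2l ?mulr_ge0 ?weight_ge0 //.
    by rewrite weight_nincr // leq_addl.
  apply: le_trans (ler_wpM2l w2 (sum_weight_excess_le b0N)) _.
  case: leqP => [bM|Mb]; first by rewrite weight_le //; lra.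
  by rewrite weight_gt ?Mb // invfM; lra.
rewrite big_nat_if // big_split /= !sum_tail_le -!mulr_sumr.
rewrite -/(H M) -/(H N) -/(h M) -/(h N); lra.
Qed.

(** The bound on the kernel as a function of (a, b) plus the same function of
(b, a): by symmetry of the weights, only one of the two needs to be summed.  On
the diagonal the excess is counted twice, which is harmless as it is
nonnegative. *)
Lemma kernel_le_split a b : (0 < a)%N -> (0 < b)%N ->
  kernel R a b <=
    (pow32 R a + if (a <= b)%N then excess R a b else 0)
  + (pow32 R b + if (b <= a)%N then excess R b a else 0).
Proof.
move=> a0 b0; case: (leqP a b) => [ab|/ltnW ba].
  have := @kernel_le R a b; rewrite a0 ab => /(_ isT).
  case: leqP => [ba|_]; last lra.
  have := @excess_ge0 R b a; rewrite b0 ba => /(_ isT); lra.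
rewrite ba kernelC.
by have := @kernel_le R b a; rewrite b0 ba => /(_ isT); lra.
Qed.

Lemma cutoff_cubic_lt : ~ (s = 0 /\ t = 0) ->
  \sum_(1 <= a < N.+1) \sum_(1 <= b < N.+1)
    weight a * weight b * weight (a + b)%N * kernel R a b <
  2 * (\sum_(1 <= a < N.+1) weight a * pow32 R a)
    * \sum_(1 <= n < N.+1) weight n ^+ 2.
Proof.
move=> st0; rewrite sum_weight_sqr.
pose f a b := pow32 R a + if (a <= b)%N then excess R a b else 0.
pose W a b := weight a * weight b * weight (a + b)%N.
have W0 a b : 0 <= W a b by rewrite !mulr_ge0 ?weight_ge0.
(* The weights are symmetric in a and b. *)
have Wsym : \sum_(1 <= a < N.+1) \sum_(1 <= b < N.+1) W a b * f b a =
    \sum_(1 <= a < N.+1) \sum_(1 <= b < N.+1) W a b * f a b.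
  rewrite exchange_big_nat /=; apply: eq_bigr => a _; apply: eq_bigr => b _.
  by rewrite /W addnC (mulrC (weight b)).
have bound : \sum_(1 <= a < N.+1) \sum_(1 <= b < N.+1) W a b * kernel R a b <=
    2 * \sum_(1 <= a < N.+1) \sum_(1 <= b < N.+1) W a b * f a b.
  rewrite mulr_natl mulr2n -{2}Wsym -big_split /=.
  apply: ler_sum_nat => a /andP[a0 _]; rewrite -big_split /=.
  apply: ler_sum_nat => b /andP[b0 _]; rewrite -mulrDr.
  by rewrite ler_wpM2l // kernel_le_split.
apply: le_lt_trans bound _.
have -> : \sum_(1 <= a < N.+1) \sum_(1 <= b < N.+1) W a b * f a b =
  \sum_(1 <= a < N.+1) \sum_(1 <= b < N.+1) W a b * pow32 R a +
  \sum_(1 <= a < N.+1) \sum_(1 <= b < N.+1)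
    W a b * (if (a <= b)%N then excess R a b else 0).
  rewrite -big_split /=; apply: eq_bigr => a _.
  by rewrite -big_split /=; apply: eq_bigr => b _; rewrite mulrDr.
have := sum_leading_le; have := sum_excess_total_le; rewrite -/W.
move: (\sum_(1 <= a < _) _) (\sum_(1 <= a < _) _) (\sum_(1 <= a < _) _)
  => S2 S1 A hS2 hS1.
have [L0 HN] := invsqrt_sum_growth R leMN.
have HM0 : 0 < H M.
  apply: (@lt_le_trans _ _ (H 1)).
    by rewrite /invsqrt_sum big_nat1 sqrtr1 invr1.
  rewrite /invsqrt_sum (@big_cat_nat _ _ _ 2 1 M.+1) //= lerDl.
  by rewrite sumr_ge0 // => k _; rewrite invr_ge0 sqrtr_ge0.
have t3 : 0 <= t ^+ 3 by rewrite exprn_ge0.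
have := mulr_gt0 HM0 (cutoff_margin_gt0 s_ge0 t_ge0 st0 L0).
have := ler_wpM2l t3 HN.
lra.
Qed.

End TwoCutoffs.

(** * The sums for a finitely supported sequence *)

Lemma nneseries_finite_support (R : realType) (f : nat -> \bar R) (K : nat) :
  (forall n, 0 <= f n)%E -> (forall n, (K < n)%N -> f n = 0%E) ->
  (\sum_(1 <= n <oo) f n = \sum_(1 <= n < K.+1) f n)%E.
Proof.
move=> f0 fK; rewrite (nneseries_split 1 K) // add1n.
by rewrite eseries0 ?adde0 // => n Kn _; exact: fK.
Qed.

Lemma esum_pos_finite_support (R : realType) (f : nat -> \bar R) (K : nat) :
  (forall n, 0 <= f n)%E -> (forall n, (K < n)%N -> f n = 0%E) ->
  (\esum_(n in [set n : nat | (1 <= n)%N]%classic) f n = \sum_(1 <= n < K.+1) f n)%E.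
Proof.
move=> f0 fK; rewrite -nneseries_esum // -ereal_series.
exact: nneseries_finite_support.
Qed.

Section FiniteSupport.
Variables (R : realType) (K : nat) (x : nat -> R).
Hypotheses (x_ge0 : forall n, 0 <= x n) (x_supp : forall n, (K < n)%N -> x n = 0).

Lemma seqA_fin : seqA x = (\sum_(1 <= n < K.+1) x n)%:E.
Proof.
rewrite -sumEFin; apply: nneseries_finite_support => n; first by rewrite lee_fin.
by move=> /x_supp ->.
Qed.

Lemma seqE3_fin : seqE3 x = (\sum_(1 <= n < K.+1) n%:R ^+ 3 * x n ^+ 2)%:E.
Proof.
rewrite -sumEFin; apply: nneseries_finite_support => n.
  by rewrite lee_fin mulr_ge0 ?exprn_ge0.
by move=> /x_supp ->; rewrite expr0n mulr0.
Qed.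

Definition cubic_term (a b : nat) : R :=
  (a + b)%:R * (a ^ 2 + a * b + b ^ 2)%:R * x a * x b * x (a + b)%N.

Lemma seqC_fin : seqC x =
  (\sum_(1 <= a < K.+1) \sum_(1 <= b < K.+1) cubic_term a b)%:E.
Proof.
have c0 a b : (0 <= (cubic_term a b)%:E)%E.
  by rewrite lee_fin !mulr_ge0.
pose I := [set n : nat | (1 <= n)%N]%classic.
have -> : seqC x = \esum_(a in I) \esum_(b in I) (cubic_term a b)%:E.
  rewrite esum_esum //; congr esum.
rewrite (@esum_pos_finite_support _ _ K); first last.
- move=> a Ka; apply: esum1 => b _.
  by rewrite /cubic_term (x_supp Ka) mulr0 !mul0r.
- by move=> a; apply: esum_ge0.
rewrite -sumEFin; apply: eq_bigr => a _.
rewrite (@esum_pos_finite_support _ _ K) ?sumEFin // => b Kb.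
by rewrite /cubic_term (x_supp Kb) mulr0 mul0r.
Qed.

End FiniteSupport.

Lemma sum_multiples (V : nmodType) (q n : nat) (F : nat -> V) : (0 < q)%N ->
  (forall k, ~~ (q %| k)%N -> F k = 0) ->
  \sum_(1 <= k < (q * n).+1) F k = \sum_(1 <= k < n.+1) F (q * k)%N.
Proof.
move=> q0 F0; elim: n => [|n IH]; first by rewrite muln0 !big_geq.
rewrite [RHS]big_nat_recr //= -IH (@big_cat_nat _ _ _ (q * n).+1) //=; last first.
  by rewrite ltnS leq_mul2l leqnSn orbT.
congr (_ + _); rewrite big_nat_recr /=; last by rewrite ltn_mul2l q0 /=.
rewrite big_nat big1 ?add0r // => k /andP[lk ku]; apply: F0; apply/negP.
move=> /dvdnP[j jE]; move: lk ku; rewrite jE (mulnC j) !ltn_pmul2l //; lia.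
Qed.

(** * Dilation *)

Section Dilation.
Variables (R : realType) (q K : nat) (x : nat -> R).
Hypotheses (q_gt0 : (0 < q)%N) (x_ge0 : forall n, 0 <= x n)
  (x_supp : forall n, (K < n)%N -> x n = 0).

Lemma dilate_mul n : dilate q x (q * n)%N = x n.
Proof. by rewrite /dilate dvdn_mulr // mulKn. Qed.

Lemma dilate_ndvd k : ~~ (q %| k)%N -> dilate q x k = 0.
Proof. by rewrite /dilate => /negbTE ->. Qed.

Lemma dilate_ge0 k : 0 <= dilate q x k.
Proof. by rewrite /dilate; case: ifP. Qed.

Lemma dilate_supp k : (q * K < k)%N -> dilate q x k = 0.
Proof.
rewrite /dilate; case: ifP => // /dvdnP[j ->].
by rewrite mulnK // mulnC ltn_pmul2r // => /x_supp.
Qed.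

Lemma seqA_dilate : seqA (dilate q x) = seqA x.
Proof.
rewrite (seqA_fin dilate_ge0 dilate_supp) (seqA_fin x_ge0 x_supp).
rewrite sum_multiples //; last exact: dilate_ndvd.
by under eq_bigr do rewrite dilate_mul.
Qed.

Lemma seqE3_dilate : seqE3 (dilate q x) = ((q%:R ^+ 3)%:E * seqE3 x)%E.
Proof.
rewrite (seqE3_fin dilate_ge0 dilate_supp) (seqE3_fin x_ge0 x_supp) -EFinM.
rewrite sum_multiples //; last by move=> k /dilate_ndvd ->; rewrite expr0n mulr0.
rewrite mulr_sumr; congr _%:E; apply: eq_bigr => n _.
by rewrite dilate_mul natrM exprMn [RHS]mulrA.
Qed.

Lemma seqC_dilate : seqC (dilate q x) = ((q%:R ^+ 3)%:E * seqC x)%E.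
Proof.
rewrite (seqC_fin dilate_ge0 dilate_supp) (seqC_fin x_ge0 x_supp) -EFinM.
congr _%:E; rewrite sum_multiples //; last first.
  move=> a /dilate_ndvd x0; apply: big1 => b _.
  by rewrite /cubic_term x0 mulr0 !mul0r.
rewrite mulr_sumr; apply: eq_bigr => a _.
rewrite sum_multiples //; last first.
  by move=> b /dilate_ndvd x0; rewrite /cubic_term x0 mulr0 mul0r.
rewrite mulr_sumr; apply: eq_bigr => b _.
rewrite /cubic_term -mulnDr !dilate_mul.
have -> : ((q * a) ^ 2 + q * a * (q * b) + (q * b) ^ 2 =
  q ^ 2 * (a ^ 2 + a * b + b ^ 2))%N by ring.
by rewrite [(q * (a + b))%:R]natrM [(q ^ 2 * _)%:R]natrM natrX; ring.
Qed.

End Dilation.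

(** * Two-step sequences *)

Lemma powR_neg32 (R : realType) (n : nat) :
  n%:R `^ (- (3 / 2)) = pow32 R n.
Proof.
rewrite powRN /pow32 (_ : 3 / 2 = 1 + 2^-1); last by field.
by rewrite powRD ?powRr1 ?powR12_sqrt //; apply/implyP => /eqP; lra.
Qed.

Section TwoStep.
Variables (R : realType) (M N : nat) (s t : R).
Hypotheses (M_gt0 : (0 < M)%N) (leMN : (M <= N)%N) (s_ge0 : 0 <= s) (t_ge0 : 0 <= t).

Local Notation x := (two_step M N s t).
Local Notation w := (weight M N s t).

Lemma two_step_ge0 n : 0 <= x n.
Proof. by rewrite mulr_ge0 ?powR_ge0 // addr_ge0 // mulr_ge0. Qed.

Lemma two_step_supp n : (N < n)%N -> x n = 0.
Proof.
move=> Nn; rewrite /two_step [(n <= N)%N]leqNgt Nn.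
by rewrite [(n <= M)%N]leqNgt (leq_ltn_trans leMN Nn) !andbF !mulr0 addr0 mulr0.
Qed.

Lemma two_stepE n : (0 < n)%N -> x n = w n * pow32 R n.
Proof. by move=> n0; rewrite /two_step n0 powR_neg32 mulrC. Qed.

Lemma seqC_two_step_lt : ~ (s = 0 /\ t = 0) -> (seqC x < 2%:E * seqA x * seqE3 x)%E.
Proof.
move=> st0.
have fA := seqA_fin two_step_ge0 two_step_supp.
have fE := seqE3_fin two_step_ge0 two_step_supp.
have fC := seqC_fin two_step_ge0 two_step_supp.
rewrite {}fA {}fE {}fC -!EFinM lte_fin.
have -> : \sum_(1 <= n < N.+1) x n = \sum_(1 <= n < N.+1) w n * pow32 R n.
  by apply: eq_big_nat => n /andP[n0 _]; rewrite two_stepE.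
have -> : \sum_(1 <= n < N.+1) n%:R ^+ 3 * x n ^+ 2 = \sum_(1 <= n < N.+1) w n ^+ 2.
  apply: eq_big_nat => n /andP[n0 _]; rewrite two_stepE // /pow32.
  have r0 := sqrt_nat_gt0 R n0; have rE := sqr_sqrt_nat R n.
  by move: (Num.sqrt _) r0 rE => r r0 <-; field; rewrite gt_eqF.
rewrite (_ : \sum_(1 <= a < N.+1) _ = \sum_(1 <= a < N.+1) \sum_(1 <= b < N.+1)
    w a * w b * w (a + b)%N * kernel R a b); first exact: cutoff_cubic_lt.
apply: eq_big_nat => a /andP[a0 _]; apply: eq_big_nat => b /andP[b0 _].
have ab0 : (0 < a + b)%N by rewrite addn_gt0 a0.
rewrite /cubic_term !two_stepE // /kernel /pow32.
(* Both sides are linear in a^2 + a b + b^2, so it can be any number k. *)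
move: (_ + _ + b ^ 2)%N => k.
have u0 := sqrt_nat_gt0 R a0; have v0 := sqrt_nat_gt0 R b0.
have z0 := sqrt_nat_gt0 R ab0; field.
by rewrite -?natrD !gt_eqF ?ltr0n.
Qed.

End TwoStep.

Theorem theorem3p23 (R : realType) (M N : nat) (s t : R)
    (hM : (1 <= M)%N) (hMN : (M <= N)%N) (hs : 0 <= s) (ht : 0 <= t)
    (hst : ~ (s = 0 /\ t = 0)) :
  (seqC (two_step M N s t) <
     2%:E * seqA (two_step M N s t) * seqE3 (two_step M N s t))%E /\
  (forall q : nat, (1 <= q)%N ->
    (seqC (dilate q (two_step M N s t)) <
       2%:E * seqA (dilate q (two_step M N s t))
            * seqE3 (dilate q (two_step M N s t)))%E).
Proof.
have main := seqC_two_step_lt hM hMN hs ht hst.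
split=> // q q0.
have x0 := two_step_ge0 M N hs ht; have xN := two_step_supp s t hMN.
rewrite (seqC_dilate q0 x0 xN) (seqA_dilate q0 x0 xN) (seqE3_dilate q0 x0 xN).
by rewrite muleCA lte_pmul2l // lte_fin exprn_gt0 // ltr0n.
Qed.
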